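(* Let $a_1,a_2,a_3,b_1,b_2,c_1,c_2 \in \mathbb{R}$ and let $$A = \begin{pmatrix} a_1 & 0 & 0 \\0 & a_2 & 0 \\ c_1 & c_2 & a_3 \end{pmatrix}, \qquad B = \begin{pmatrix} 0 & 0 & b_1\\0 & 0 & b_2\\ 0 & 0 & 0 \end{pmatrix}.$$ The pair $(A, B)$ is diagonally Riccati stable if and only if all of the following hold: (i) $a_i < 0$ for $1 \leq i \leq 3$; (ii) $a_1a_3 > |c_1b_1|$ and $a_2a_3 > |b_2c_2|$; (iii) $|a_1a_2a_3| > |a_1b_2c_2+b_1c_1a_2|$.
   Context: $M \succ 0$ ($M \prec 0$) means that the real matrix $M=M^T$ is positive definite (negative definite). A pair $(A,B)$ of matrices in $\mathbb{R}^{n\times n}$ is diagonally Riccati stable if there exist diagonal $P \succ 0$, $Q \succ 0$ in $\mathbb{R}^{n \times n}$ with $A^TP+PA + Q + PBQ^{-1}B^TP \prec 0$. *)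

(* Defs.v *)
From mathcomp Require Import all_boot all_order all_algebra reals.

Set Implicit Arguments.
Unset Strict Implicit.
Unset Printing Implicit Defensive.

Import Order.TTheory GRing.Theory Num.Theory.
Local Open Scope ring_scope.

Definition posdefmx (R : realType) (n : nat) (M : 'M[R]_n) : Prop :=
  M^T = M /\ forall x : 'cV[R]_n, x != 0 -> 0 < (x^T *m M *m x) 0 0.

Definition negdefmx (R : realType) (n : nat) (M : 'M[R]_n) : Prop :=
  M^T = M /\ forall x : 'cV[R]_n, x != 0 -> (x^T *m M *m x) 0 0 < 0.

(* Q is positive definite, hence a unit, so [invmx Q] is its actual inverse. *)
Definition diag_riccati_stable (R : realType) (n : nat) (A B : 'M[R]_n) : Prop :=
  exists P Q : 'M[R]_n,
    [/\ is_diag_mx P, is_diag_mx Q, posdefmx P, posdefmx Q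
      & negdefmx (A^T *m P + P *m A + Q + P *m B *m invmx Q *m B^T *m P)].

Definition mx3_of_rows (R : realType) (rows : seq (seq R)) : 'M[R]_3 :=
  \matrix_(i < 3, j < 3) (nth [::] rows i)`_j.

(* Main.v *)
Require Import Defs.
From mathcomp Require Import all_boot all_order all_algebra reals.
From mathcomp Require Import ring lra.

Set Implicit Arguments.
Unset Strict Implicit.
Unset Printing Implicit Defensive.

Import Order.TTheory GRing.Theory Num.Theory.
Local Open Scope ring_scope.

(** Write P = diag(p1, p2, p3) and Q = diag(q1, q2, q3).  The Riccati form of
    the pair, [riccati_form] below, is

      2 a1 p1 x^2 + 2 a2 p2 y^2 + 2 a3 p3 z^2 + 2 p3 z (c1 x + c2 y)
        + q1 x^2 + q2 y^2 + q3 z^2 + (p1 b1 x + p2 b2 y)^2 / q3,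

    so the question is for which coefficients some positive p and q make it
    negative away from the origin.

    The last two conditions say, after division by a1, a2 or a1 a2, that
    |b1 c1 / a1|, |b2 c2 / a2| and |b1 c1 / a1 + b2 c2 / a2| are all less than
    - a3 ([ltr_norm_ndiv], [ltr_norm_sum_div]).

    Necessity.  By the AM-GM inequality, q3 z^2 + w^2 / q3 >= 2 s z w for both
    signs s, so Q can be traded for cross terms without losing negativity
    ([arrow_form_lt0]).  What remains has the coefficients 2 (p3 ci + s pi bi)
    in front of x z and y z, and the square of such a coefficient is at least
    16 s pi p3 bi ci, again by AM-GM.  So testing the form at z = 1, where it
    is stationary in x, in y, or in both, gives inequalities from which p
    cancels ([stationary_ge]); taking both signs s puts in the absolute values.

    Sufficiency.  Take p3 = 1 and q3 = - a3.  Maximising in z, the problem is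
    reduced to an inequality between two binary quadratic forms
    ([diagonal_certificate]):

      (c1 x + c2 y)^2 + (p1 b1 x + p2 b2 y)^2
         <= - 2 T (a1 p1 x^2 + a2 p2 y^2)  for some T < - a3.

    The weight pi should balance ci^2 against pi^2 bi^2, as then their sum is
    2 pi |bi ci|, the smallest possible.  If b1 c1 and b2 c2 have opposite
    signs, this choice makes the two cross terms cancel, and it is enough that
    each |bi ci / ai| is less than - a3.
    Otherwise Cauchy-Schwarz bounds the left-hand side using
    |b1 c1 / a1| + |b2 c2 / a2| = |b1 c1 / a1 + b2 c2 / a2| < - a3; the strict
    inequality leaves room for an approximate balance ([balancing_weight]) when
    some bi or ci vanishes. *)

(** * Explicit 3 by 3 matrices *)

Definition mx3 (R : realType) (a b c d e f g h i : R) : 'M[R]_3 :=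
  mx3_of_rows [:: [:: a; b; c]; [:: d; e; f]; [:: g; h; i]].

Definition diag3 (R : realType) (a b c : R) : 'M[R]_3 :=
  mx3 a 0 0 0 b 0 0 0 c.

Definition col3 (R : realType) (x y z : R) : 'cV[R]_3 :=
  \col_(i < 3) [:: x; y; z]`_i.

Section Matrices3.

Variable R : realType.
Implicit Types (M N : 'M[R]_3) (v : 'cV[R]_3).

Lemma eq_mx3 M N :
  M 0 0 = N 0 0 -> M 0 1 = N 0 1 -> M 0 2%:R = N 0 2%:R ->
  M 1 0 = N 1 0 -> M 1 1 = N 1 1 -> M 1 2%:R = N 1 2%:R ->
  M 2%:R 0 = N 2%:R 0 -> M 2%:R 1 = N 2%:R 1 -> M 2%:R 2%:R = N 2%:R 2%:R ->
  M = N.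
Proof.
move=> *; apply/matrixP=> i j.
have ord3 (k : 'I_3) : [|| k == 0, k == 1 | k == 2%:R].
  by case: k => [[|[|[|]]]].
by case/or3P: (ord3 i) => /eqP->; case/or3P: (ord3 j) => /eqP->.
Qed.

Lemma sum3 (F : 'I_3 -> R) : \sum_i F i = F 0 + F 1 + F 2%:R.
Proof.
rewrite !big_ord_recl big_ord0 addr0 addrA.
by congr (_ + F _ + F _); apply: val_inj.
Qed.

Lemma mulmx3 (a b c d e f g h i a' b' c' d' e' f' g' h' i' : R) :
  mx3 a b c d e f g h i *m mx3 a' b' c' d' e' f' g' h' i' =
  mx3 (a * a' + b * d' + c * g') (a * b' + b * e' + c * h')
      (a * c' + b * f' + c * i')
      (d * a' + e * d' + f * g') (d * b' + e * e' + f * h')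
      (d * c' + e * f' + f * i')
      (g * a' + h * d' + i * g') (g * b' + h * e' + i * h')
      (g * c' + h * f' + i * i').
Proof. by apply: eq_mx3; rewrite mxE sum3 !mxE. Qed.

Lemma addmx3 (a b c d e f g h i a' b' c' d' e' f' g' h' i' : R) :
  mx3 a b c d e f g h i + mx3 a' b' c' d' e' f' g' h' i' =
  mx3 (a + a') (b + b') (c + c') (d + d') (e + e') (f + f')
      (g + g') (h + h') (i + i').
Proof. by apply: eq_mx3; rewrite !mxE. Qed.

Lemma trmx3 (a b c d e f g h i : R) :
  (mx3 a b c d e f g h i)^T = mx3 a d g b e h c f i.
Proof. by apply: eq_mx3; rewrite !mxE. Qed.

Lemma quad_mx3 (a b c d e f g h i x y z : R) :
  ((col3 x y z)^T *m mx3 a b c d e f g h i *m col3 x y z) 0 0 =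
  a * x ^+ 2 + e * y ^+ 2 + i * z ^+ 2
  + (b + d) * (x * y) + (c + g) * (x * z) + (f + h) * (y * z).
Proof. by rewrite mxE sum3 !mxE !sum3 !mxE /=; ring. Qed.

Lemma is_diag_diag3 (a b c : R) : is_diag_mx (diag3 a b c).
Proof.
by apply/is_diag_mxP=> -[[|[|[|]]] // ?] [[|[|[|]]] // ?]; rewrite mxE.
Qed.

Lemma diag3E M : is_diag_mx M -> M = diag3 (M 0 0) (M 1 1) (M 2%:R 2%:R).
Proof.
by move/is_diag_mxP=> dM; apply: eq_mx3; rewrite [RHS]mxE //=; apply: dM.
Qed.

Lemma invmx_diag3 (a b c : R) : a != 0 -> b != 0 -> c != 0 ->
  invmx (diag3 a b c) = diag3 a^-1 b^-1 c^-1.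
Proof.
move=> a0 b0 c0.
have VM : diag3 a b c *m diag3 a^-1 b^-1 c^-1 = 1%:M.
  rewrite /diag3 mulmx3 !(mul0r, mulr0, addr0, add0r) !divff //.
  by apply: eq_mx3; rewrite !mxE.
have [u _] := mulmx1_unit VM.
by rewrite -[LHS]mulmx1 -VM mulKmx.
Qed.

Lemma col3E v : v = col3 (v 0 0) (v 1 0) (v 2%:R 0).
Proof.
apply/colP => -[[|[|[|]]] // p]; rewrite !mxE /=;
  by congr (v _ _); apply: val_inj.
Qed.

Lemma col3_neq0 (x y z : R) :
  (col3 x y z != 0) = [|| x != 0, y != 0 | z != 0].
Proof.
apply/idP/idP; last first.
  apply: contraTN => /eqP/colP e.
  by move: (e 0) (e 1) (e 2%:R); rewrite !mxE /= => -> -> ->; rewrite eqxx.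
apply: contraNT; rewrite !negb_or !negbK => /and3P[/eqP-> /eqP-> /eqP->].
by apply/eqP/colP=> -[[|[|[|]]] // p]; rewrite !mxE.
Qed.

Lemma posdef_diag3 (a b c : R) :
  posdefmx (diag3 a b c) <-> [/\ 0 < a, 0 < b & 0 < c].
Proof.
split=> [[_ pos]|[a0 b0 c0]].
  have e x y z : [|| x != 0, y != 0 | z != 0] ->
      0 < a * x ^+ 2 + b * y ^+ 2 + c * z ^+ 2.
    rewrite -col3_neq0 => /pos; rewrite quad_mx3.
    by rewrite !(mul0r, addr0).
  have := e 1 0 0; have := e 0 1 0; have := e 0 0 1.
  rewrite oner_neq0 eqxx /= => /(_ isT) + /(_ isT) + /(_ isT).
  by split; lra.
split=> [|v]; first by rewrite /diag3 trmx3.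
rewrite (col3E v) col3_neq0 quad_mx3 !(mul0r, addr0).
set x := v 0 0; set y := v 1 0; set z := v 2%:R 0 => nz.
have ax : 0 <= a * x ^+ 2 by rewrite mulr_ge0 ?sqr_ge0 // ltW.
have bY : 0 <= b * y ^+ 2 by rewrite mulr_ge0 ?sqr_ge0 // ltW.
have cz : 0 <= c * z ^+ 2 by rewrite mulr_ge0 ?sqr_ge0 // ltW.
have sq d t : 0 < d -> t != 0 -> 0 < d * t ^+ 2 :> R.
  by move=> d0 t0; rewrite mulr_gt0 // lt_def sqr_ge0 sqrf_eq0 t0.
by case/or3P: nz => [/(sq _ _ a0)|/(sq _ _ b0)|/(sq _ _ c0)]; lra.
Qed.

End Matrices3.

(** * The Riccati form *)

Section RiccatiForm.

Variable R : realType.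
Implicit Types (a b c p q x y z w T : R).

Definition riccati_form a1 a2 a3 b1 b2 c1 c2 p1 p2 p3 q1 q2 q3 x y z :=
  2 * a1 * p1 * x ^+ 2 + 2 * a2 * p2 * y ^+ 2 + 2 * a3 * p3 * z ^+ 2
  + 2 * p3 * z * (c1 * x + c2 * y)
  + q1 * x ^+ 2 + q2 * y ^+ 2 + q3 * z ^+ 2
  + (p1 * b1 * x + p2 * b2 * y) ^+ 2 / q3.

Lemma riccati_formP a1 a2 a3 b1 b2 c1 c2 :
  diag_riccati_stable (mx3 a1 0 0 0 a2 0 c1 c2 a3) (mx3 0 0 b1 0 0 b2 0 0 0)
  <-> exists p1 p2 p3 q1 q2 q3 : R,
    [/\ [/\ 0 < p1, 0 < p2 & 0 < p3], [/\ 0 < q1, 0 < q2 & 0 < q3]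
      & forall x y z, [|| x != 0, y != 0 | z != 0] ->
          riccati_form a1 a2 a3 b1 b2 c1 c2 p1 p2 p3 q1 q2 q3 x y z < 0].
Proof.
set A := mx3 a1 _ _ _ _ _ _ _ _; set B := mx3 _ _ b1 _ _ _ _ _ _.
pose S p1 p2 p3 q1 q2 q3 : 'M[R]_3 :=
  A^T *m diag3 p1 p2 p3 + diag3 p1 p2 p3 *m A + diag3 q1 q2 q3
  + diag3 p1 p2 p3 *m B *m invmx (diag3 q1 q2 q3) *m B^T *m diag3 p1 p2 p3.
have S_def p1 p2 p3 q1 q2 q3 : 0 < q1 -> 0 < q2 -> 0 < q3 ->
    negdefmx (S p1 p2 p3 q1 q2 q3) <->
    forall x y z, [|| x != 0, y != 0 | z != 0] ->
      riccati_form a1 a2 a3 b1 b2 c1 c2 p1 p2 p3 q1 q2 q3 x y z < 0.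
  move=> q10 q20 q30; rewrite /S invmx_diag3 ?gt_eqF //.
  rewrite /A /B /diag3 !(trmx3, mulmx3, addmx3) !(mul0r, mulr0, addr0, add0r).
  set N := mx3 _ _ _ _ _ _ _ _ _.
  have formE x y z : ((col3 x y z)^T *m N *m col3 x y z) 0 0 =
      riccati_form a1 a2 a3 b1 b2 c1 c2 p1 p2 p3 q1 q2 q3 x y z.
    by rewrite quad_mx3 /riccati_form; ring.
  split=> [[_ neg] x y z|neg].
    by rewrite -col3_neq0 => /neg; rewrite formE.
  split=> [|v].
    by rewrite trmx3; apply: eq_mx3; rewrite !mxE //=; ring.
  by rewrite (col3E v) col3_neq0 formE; apply: neg.
split.
  case=> P [Q [/diag3E-> /diag3E-> /posdef_diag3 posP /posdef_diag3 posQ neg]].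
  do 6!eexists; split; [exact: posP|exact: posQ|].
  by case: posQ => q1 q2 q3; apply/S_def.
case=> p1 [p2 [p3 [q1 [q2 [q3 [posP posQ neg]]]]]].
exists (diag3 p1 p2 p3), (diag3 q1 q2 q3).
split; [exact: is_diag_diag3|exact: is_diag_diag3|exact/posdef_diag3
       |exact/posdef_diag3|].
by case: posQ => *; apply/S_def.
Qed.

(** * Necessity *)

(** AM-GM in the form q z^2 + w^2 / q >= 2 s z w removes Q, at the price of an
    arbitrary sign s = 1 or s = -1. *)
Lemma arrow_form_lt0 a1 a2 a3 b1 b2 c1 c2 p1 p2 p3 q1 q2 q3 s x y z :
    s ^+ 2 = 1 -> 0 < q1 -> 0 < q2 -> 0 < q3 ->
    riccati_form a1 a2 a3 b1 b2 c1 c2 p1 p2 p3 q1 q2 q3 x y z < 0 ->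
  a1 * p1 * x ^+ 2 + a2 * p2 * y ^+ 2 + a3 * p3 * z ^+ 2
  + z * ((p3 * c1 + s * (p1 * b1)) * x + (p3 * c2 + s * (p2 * b2)) * y) < 0.
Proof.
move=> s2 q10 q20 q30; rewrite /riccati_form.
set w := p1 * b1 * x + p2 * b2 * y => neg.
have q1x : 0 <= q1 * x ^+ 2 by rewrite mulr_ge0 ?sqr_ge0 // ltW.
have q2y : 0 <= q2 * y ^+ 2 by rewrite mulr_ge0 ?sqr_ge0 // ltW.
have amgm : 2 * s * z * w <= q3 * z ^+ 2 + w ^+ 2 / q3.
  rewrite -subr_ge0 (_ : _ - _ = (q3 * z - s * w) ^+ 2 / q3).
    by rewrite divr_ge0 ?sqr_ge0 // ltW.
  have -> : (q3 * z - s * w) ^+ 2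
      = (q3 * z) ^+ 2 - 2 * s * q3 * z * w + s ^+ 2 * w ^+ 2 by ring.
  by rewrite s2; field; rewrite gt_eqF.
have -> : z * ((p3 * c1 + s * (p1 * b1)) * x + (p3 * c2 + s * (p2 * b2)) * y)
    = p3 * z * (c1 * x + c2 * y) + s * z * w by rewrite /w; ring.
lra.
Qed.

(** With e = r c + s p b, the left-hand side takes its maximum - e^2 / (4 a p)
    at x = - e / (2 a p), and AM-GM gives e^2 >= 4 s p r b c. *)
Lemma stationary_ge a b c p r s : a < 0 -> 0 < p ->
  exists x,
    a * p * x ^+ 2 + (r * c + s * (p * b)) * x >= - (s * r * (b * c) / a).
Proof.
move=> a0 p0; set e := r * c + s * (p * b).
exists (- e / (2 * a * p)).
have -> : a * p * (- e / (2 * a * p)) ^+ 2 + e * (- e / (2 * a * p))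
    = - (s * r * (b * c) / a) - (r * c - s * (p * b)) ^+ 2 / (4 * p) / a.
  have -> : (r * c - s * (p * b)) ^+ 2 = e ^+ 2 - 4 * s * r * p * b * c.
    by rewrite /e; ring.
  by field; rewrite (lt_eqF a0) (gt_eqF p0).
rewrite lerDl oppr_ge0 mulr_ge0_le0 ?invr_le0 ?(ltW a0) //.
by rewrite divr_ge0 ?sqr_ge0 // mulr_ge0 // ltW.
Qed.

Lemma lt_norm_of_signs (u v : R) :
  (forall s, s ^+ 2 = 1 -> - (s * u) < v) -> `|u| < v.
Proof.
move=> h; rewrite ltr_norml; apply/andP; split.
  by have := h 1; rewrite expr1n mul1r ltrNl; apply.
by have := h (-1); rewrite sqrrN expr1n mulN1r opprK; apply.
Qed.

Lemma riccati_necessary a1 a2 a3 b1 b2 c1 c2 p1 p2 p3 q1 q2 q3 :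
    0 < p1 -> 0 < p2 -> 0 < p3 -> 0 < q1 -> 0 < q2 -> 0 < q3 ->
    (forall x y z, [|| x != 0, y != 0 | z != 0] ->
      riccati_form a1 a2 a3 b1 b2 c1 c2 p1 p2 p3 q1 q2 q3 x y z < 0) ->
  [/\ [/\ a1 < 0, a2 < 0 & a3 < 0],
      `|b1 * c1 / a1| < - a3, `|b2 * c2 / a2| < - a3
    & `|b1 * c1 / a1 + b2 * c2 / a2| < - a3].
Proof.
move=> p10 p20 p30 q10 q20 q30 neg.
have arrow s x y z : s ^+ 2 = 1 -> [|| x != 0, y != 0 | z != 0] ->
    a1 * p1 * x ^+ 2 + a2 * p2 * y ^+ 2 + a3 * p3 * z ^+ 2
    + z * ((p3 * c1 + s * (p1 * b1)) * x + (p3 * c2 + s * (p2 * b2)) * y) < 0.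
  by move=> s2 /neg; apply: arrow_form_lt0.
have one := expr1n R 2.
have a10 : a1 < 0.
  rewrite -(pmulr_llt0 _ p10); have := arrow 1 1 0 0 one.
  by rewrite oner_neq0 => /(_ isT); lra.
have a20 : a2 < 0.
  rewrite -(pmulr_llt0 _ p20); have := arrow 1 0 1 0 one.
  by rewrite oner_neq0 orbT => /(_ isT); lra.
have a30 : a3 < 0.
  rewrite -(pmulr_llt0 _ p30); have := arrow 1 0 0 1 one.
  by rewrite oner_neq0 !orbT => /(_ isT); lra.
have cancel s x y u : s ^+ 2 = 1 ->
    - (s * p3 * u) <= a1 * p1 * x ^+ 2 + (p3 * c1 + s * (p1 * b1)) * x
         + (a2 * p2 * y ^+ 2 + (p3 * c2 + s * (p2 * b2)) * y) ->
    - (s * u) < - a3.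
  move=> s2 le; have : p3 * (a3 - s * u) < 0.
    by have := arrow s x y 1 s2; rewrite oner_neq0 !orbT => /(_ isT); lra.
  by rewrite pmulr_rlt0 //; lra.
have st1 s := stationary_ge b1 c1 p3 s a10 p10.
have st2 s := stationary_ge b2 c2 p3 s a20 p20.
split=> //; apply: lt_norm_of_signs => s s2.
- have [x le1] := st1 s; apply: (cancel s x 0) => //; lra.
- have [y le2] := st2 s; apply: (cancel s 0 y) => //; lra.
- have [x le1] := st1 s; have [y le2] := st2 s.
  by apply: (cancel s x y) => //; lra.
Qed.

(** * Sufficiency *)

(** Maximising the Riccati form in z turns 2 z u, with u = c1 x + c2 y, into
    - u^2 / a3; the gap - a3 - T pays for q1 and q2 and for strictness. *)
Lemma diagonal_certificate a1 a2 a3 b1 b2 c1 c2 p1 p2 T :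
    a1 < 0 -> a2 < 0 -> a3 < 0 -> 0 < p1 -> 0 < p2 -> T < - a3 ->
    (forall x y, (c1 * x + c2 * y) ^+ 2 + (p1 * b1 * x + p2 * b2 * y) ^+ 2
       <= - (2 * T * (a1 * p1 * x ^+ 2 + a2 * p2 * y ^+ 2))) ->
  diag_riccati_stable (mx3 a1 0 0 0 a2 0 c1 c2 a3) (mx3 0 0 b1 0 0 b2 0 0 0).
Proof.
move=> a10 a20 a30 p10 p20 Tlt le; apply/riccati_formP.
pose k := (- a3 - T) / (- a3).
have k0 : 0 < k by rewrite divr_gt0 //; lra.
have pos a p : a < 0 -> 0 < p -> 0 < - a * p * k.
  by move=> *; apply: mulr_gt0 => //; rewrite mulr_gt0 ?oppr_gt0.
exists p1, p2, 1, (- a1 * p1 * k), (- a2 * p2 * k), (- a3).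
split; [by split|by split; rewrite ?pos ?oppr_gt0|move=> x y z nz].
set u := c1 * x + c2 * y; set w := p1 * b1 * x + p2 * b2 * y.
set D := a1 * p1 * x ^+ 2 + a2 * p2 * y ^+ 2.
(* completing the square in z *)
have -> : riccati_form a1 a2 a3 b1 b2 c1 c2 p1 p2 1
      (- a1 * p1 * k) (- a2 * p2 * k) (- a3) x y z
    = k * D + (a3 * z + u) ^+ 2 / a3
      + (u ^+ 2 + w ^+ 2 + 2 * T * D) / (- a3).
  rewrite /riccati_form -/u -/w /k /D; field.
  by rewrite lt_eqF.
have le2 : (u ^+ 2 + w ^+ 2 + 2 * T * D) / (- a3) <= 0.
  rewrite mulr_le0_ge0 ?invr_ge0 //; last lra.
  by have := le x y; rewrite -/u -/w -/D; lra.
have le3 : (a3 * z + u) ^+ 2 / a3 <= 0.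
  by rewrite mulr_ge0_le0 ?sqr_ge0 // invr_le0 ltW.
have sq a p t : a < 0 -> 0 < p -> t != 0 -> a * p * t ^+ 2 < 0.
  move=> *; rewrite -mulrA nmulr_rlt0 // mulr_gt0 //.
  by rewrite lt_def sqr_ge0 sqrf_eq0 andbT.
have sq0 a p t : a < 0 -> 0 < p -> a * p * t ^+ 2 <= 0.
  by move=> a0 p0; rewrite mulr_le0_ge0 ?sqr_ge0 // mulr_le0_ge0 ?ltW.
(* k D is negative unless x = y = 0, and then the square is (a3 z)^2 *)
have [D0|D0] := ltP D 0.
  by have : k * D < 0 by [rewrite pmulr_rlt0]; lra.
have [x0 y0] : x = 0 /\ y = 0.
  have := sq0 a1 p1 x a10 p10; have := sq0 a2 p2 y a20 p20 => hy hx.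
  split; apply/eqP; apply: contraTT D0 => n0; rewrite -ltNge /D.
    by have := sq a1 p1 x a10 p10 n0; lra.
  by have := sq a2 p2 y a20 p20 n0; lra.
move: nz; rewrite x0 y0 eqxx /= => z0.
have : (a3 * z + u) ^+ 2 / a3 < 0.
  rewrite /u x0 y0 !mulr0 !addr0 pmulr_rlt0 ?invr_lt0 //.
  by rewrite lt_def sqr_ge0 sqrf_eq0 mulf_neq0 // lt_eqF.
have : k * D = 0 by rewrite /D x0 y0; ring.
lra.
Qed.

(** When b c != 0, the two squares are equal for p = |c / b|. *)
Lemma exact_balance b c : b * c != 0 ->
  exists2 p, 0 < p & p * `|b| = `|c|.
Proof.
rewrite mulf_eq0 negb_or => /andP[b0 c0].
exists (`|c| / `|b|); first by rewrite divr_gt0 ?normr_gt0.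
by rewrite divfK ?normr_eq0.
Qed.

Lemma exact_balance_sum b c p : p * `|b| = `|c| ->
  c ^+ 2 + (p * b) ^+ 2 = 2 * p * `|b * c|.
Proof.
move=> e; rewrite exprMn -(real_normK (num_real b)) -(real_normK (num_real c)).
by rewrite normrM -e; ring.
Qed.

(** If b = 0 then p must be large, and if c = 0 it must be small: the infimum
    |b c| of (c^2 + p^2 b^2) / (2 p) need not be attained, hence the slack in
    t. *)
Lemma balancing_weight b c t : `|b * c| < t ->
  exists2 p, 0 < p & c ^+ 2 + (p * b) ^+ 2 <= 2 * p * t.
Proof.
move=> lt; have t0 : 0 < t by apply: le_lt_trans lt.
have [bc0|nz] := eqVneq (b * c) 0; last first.
  have [p p0 e] := exact_balance nz; exists p => //.
  by rewrite exact_balance_sum // ler_pM2l ?ltW // mulr_gt0.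
have [b0|b0] := eqVneq b 0.
  exists ((c ^+ 2 + 1) / t).
    by rewrite divr_gt0 // ltr_wpDl ?sqr_ge0.
  rewrite b0 mulr0 expr0n addr0 -mulrA divfK ?gt_eqF //.
  by have := sqr_ge0 c; lra.
have c0 : c = 0 by apply/eqP; move/eqP: bc0; rewrite mulf_eq0 (negPf b0).
have b20 : 0 < b ^+ 2 by rewrite lt_def sqr_ge0 sqrf_eq0 b0.
exists (t / b ^+ 2); first by rewrite divr_gt0.
rewrite c0 expr0n add0r.
have -> : (t / b ^+ 2 * b) ^+ 2 = t / b ^+ 2 * t.
  by field; rewrite b0.
rewrite -[leRHS]mulrA ler_peMl ?ler1n //.
by rewrite mulr_ge0 ?divr_ge0 ?ltW.
Qed.

(** Cauchy-Schwarz with the same weights t1, t2 in both coordinates, so that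
    only the squared lengths of the plane vectors (ci, di) enter. *)
Lemma weighted_cauchy c1 c2 d1 d2 m1 m2 t1 t2 x y :
    0 < t1 -> 0 < t2 ->
    c1 ^+ 2 + d1 ^+ 2 <= m1 * t1 -> c2 ^+ 2 + d2 ^+ 2 <= m2 * t2 ->
  (c1 * x + c2 * y) ^+ 2 + (d1 * x + d2 * y) ^+ 2
    <= (t1 + t2) * (m1 * x ^+ 2 + m2 * y ^+ 2).
Proof.
move=> t10 t20 le1 le2.
have split2 u v : (u + v) ^+ 2 <= (t1 + t2) * (u ^+ 2 / t1 + v ^+ 2 / t2).
  rewrite -subr_ge0.
  have -> : (t1 + t2) * (u ^+ 2 / t1 + v ^+ 2 / t2) - (u + v) ^+ 2
      = (t2 * u - t1 * v) ^+ 2 / (t1 * t2) by field; rewrite !gt_eqF.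
  by rewrite divr_ge0 ?sqr_ge0 // mulr_ge0 // ltW.
apply: le_trans (lerD (split2 _ _) (split2 _ _)) _.
rewrite -mulrDr ler_pM2l ?addr_gt0 //.
have bound c d m t v : 0 < t -> c ^+ 2 + d ^+ 2 <= m * t ->
    (c * v) ^+ 2 / t + (d * v) ^+ 2 / t <= m * v ^+ 2.
  move=> t0 le; rewrite -mulrDl ler_pdivrMr // !exprMn -mulrDl mulrAC.
  by rewrite ler_wpM2r ?sqr_ge0.
by have := bound _ _ _ _ x t10 le1; have := bound _ _ _ _ y t20 le2; lra.
Qed.

Lemma riccati_of_sum_lt a1 a2 a3 b1 b2 c1 c2 :
    a1 < 0 -> a2 < 0 -> a3 < 0 ->
    `|b1 * c1 / a1| + `|b2 * c2 / a2| < - a3 ->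
  diag_riccati_stable (mx3 a1 0 0 0 a2 0 c1 c2 a3) (mx3 0 0 b1 0 0 b2 0 0 0).
Proof.
move=> a10 a20 a30; set s1 := `|_ / a1|; set s2 := `|_ / a2| => lt.
(* the gap is split in three: one part for each weight, and one to keep the
   strict inequality *)
pose d := (- a3 - (s1 + s2)) / 3; have d0 : 0 < d by rewrite /d; lra.
have weight a b c : a < 0 ->
    exists2 p, 0 < p &
      c ^+ 2 + (p * b) ^+ 2 <= - (2 * a * p) * (`|b * c / a| + d).
  move=> a0; have [|p p0 le] := @balancing_weight b c (- a * (`|b * c / a| + d)).
    rewrite (normrM (b * c)) normfV (ltr0_norm a0) -ltr_pdivrMl ?oppr_gt0 // mulrC.
    by rewrite ltrDl.
  exists p => //.
  by rewrite [leRHS](_ : _ = 2 * p * (- a * (`|b * c / a| + d))) //; ring.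
have [p1 p10 le1] := weight a1 b1 c1 a10.
have [p2 p20 le2] := weight a2 b2 c2 a20.
have s1d : 0 < s1 + d by rewrite ltr_wpDl ?normr_ge0.
have s2d : 0 < s2 + d by rewrite ltr_wpDl ?normr_ge0.
apply: (@diagonal_certificate _ _ _ _ _ _ _ p1 p2 (s1 + d + (s2 + d))) => //.
  by rewrite /d; lra.
by move=> x y; have := weighted_cauchy x y s1d s2d le1 le2; lra.
Qed.

(** Exact balance gives |p1 b1 p2 b2| = |c1 c2|, and the opposite signs turn
    this into p1 b1 p2 b2 = - c1 c2, so the form to be bounded is diagonal. *)
Lemma riccati_of_opposite_signs a1 a2 a3 b1 b2 c1 c2 :
    a1 < 0 -> a2 < 0 -> a3 < 0 -> (b1 * c1) * (b2 * c2) < 0 ->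
    `|b1 * c1 / a1| < - a3 -> `|b2 * c2 / a2| < - a3 ->
  diag_riccati_stable (mx3 a1 0 0 0 a2 0 c1 c2 a3) (mx3 0 0 b1 0 0 b2 0 0 0).
Proof.
move=> a10 a20 a30 opp lt1 lt2.
have /norP[nz1 nz2] : ~~ ((b1 * c1 == 0) || (b2 * c2 == 0)).
  by rewrite -mulf_eq0 lt_eqF.
have [p1 p10 e1] := exact_balance nz1; have [p2 p20 e2] := exact_balance nz2.
pose T := Num.max `|b1 * c1 / a1| `|b2 * c2 / a2|.
apply: (@diagonal_certificate _ _ _ _ _ _ _ p1 p2 T) => //.
  by rewrite gt_max lt1 lt2.
move=> x y.
have cross : c1 * c2 + p1 * b1 * (p2 * b2) = 0.
  have neg : (b1 * b2) * (c1 * c2) < 0 by move: opp; rewrite mulrACA.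
  have abs : `|p1 * b1 * (p2 * b2)| = `|c1 * c2|.
    by rewrite !normrM (gtr0_norm p10) (gtr0_norm p20) e1 e2.
  have/eqP := abs; rewrite eqr_norm2 => /orP[]/eqP eq; last by rewrite eq subrr.
  have : p1 * p2 * ((b1 * b2) * (c1 * c2)) < 0 by rewrite pmulr_rlt0 // mulr_gt0.
  have -> : p1 * p2 * ((b1 * b2) * (c1 * c2)) = (c1 * c2) ^+ 2.
    by rewrite expr2 -{2}eq; ring.
  by rewrite ltNge sqr_ge0.
have bound a b c p v : a < 0 -> 0 < p -> p * `|b| = `|c| -> `|b * c / a| <= T ->
    (c ^+ 2 + (p * b) ^+ 2) * v ^+ 2 <= - (2 * T * (a * p * v ^+ 2)).
  move=> a0 p0 e le.
  rewrite [leRHS](_ : _ = 2 * p * (T * - a) * v ^+ 2); last by ring.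
  rewrite exact_balance_sum // ler_wpM2r ?sqr_ge0 // ler_pM2l ?mulr_gt0 //.
  by rewrite -ler_pdivrMr ?oppr_gt0 // -(ltr0_norm a0) -normfV -normrM.
have := bound a1 b1 c1 p1 x a10 p10 e1; have := bound a2 b2 c2 p2 y a20 p20 e2.
rewrite !le_max !lexx orbT => /(_ isT) le2 /(_ isT) le1.
have -> : (c1 * x + c2 * y) ^+ 2 + (p1 * b1 * x + p2 * b2 * y) ^+ 2
    = (c1 ^+ 2 + (p1 * b1) ^+ 2) * x ^+ 2 + (c2 ^+ 2 + (p2 * b2) ^+ 2) * y ^+ 2
      + 2 * (c1 * c2 + p1 * b1 * (p2 * b2)) * (x * y) by ring.
by rewrite cross; lra.
Qed.

Lemma riccati_sufficient a1 a2 a3 b1 b2 c1 c2 :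
    a1 < 0 -> a2 < 0 -> a3 < 0 ->
    `|b1 * c1 / a1| < - a3 -> `|b2 * c2 / a2| < - a3 ->
    `|b1 * c1 / a1 + b2 * c2 / a2| < - a3 ->
  diag_riccati_stable (mx3 a1 0 0 0 a2 0 c1 c2 a3) (mx3 0 0 b1 0 0 b2 0 0 0).
Proof.
move=> a10 a20 a30 lt1 lt2 lt12.
have [opp|same] := ltP ((b1 * c1) * (b2 * c2)) 0.
  exact: riccati_of_opposite_signs.
apply: riccati_of_sum_lt => //.
set u := b1 * c1 / a1 in lt12 *; set v := b2 * c2 / a2 in lt12 *.
have uv : 0 <= u * v.
  by rewrite /u /v mulrACA mulr_ge0 // -invfM invr_ge0 nmulr_rge0 // ltW.
suff -> : `|u| + `|v| = `|u + v| by [].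
have [u0|u0] := leP 0 u; have [v0|v0] := leP 0 v.
- by rewrite (ger0_norm u0) (ger0_norm v0) ger0_norm // addr_ge0.
- have -> : u = 0 by apply/eqP; rewrite eq_le u0 -(nmulr_lge0 _ v0) uv.
  by rewrite normr0 !add0r.
- have -> : v = 0 by apply/eqP; rewrite eq_le v0 -(nmulr_rge0 _ u0) uv.
  by rewrite normr0 !addr0.
- rewrite (ltr0_norm u0) (ltr0_norm v0) ltr0_norm ?opprD //.
  by rewrite -oppr_gt0 opprD addr_gt0 ?oppr_gt0.
Qed.

Lemma ltr_norm_ndiv u a d : a < 0 -> (`|u / a| < - d) = (`|u| < a * d).
Proof.
move=> a0; rewrite normrM normfV (ltr0_norm a0) ltr_pdivrMr ?oppr_gt0 //.
by rewrite mulrNN mulrC.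
Qed.

Lemma ltr_norm_sum_div a1 a2 a3 u v : a1 < 0 -> a2 < 0 -> a3 < 0 ->
  (`|u / a1 + v / a2| < - a3) = (`|a1 * v + u * a2| < `|a1 * a2 * a3|).
Proof.
move=> a10 a20 a30; have a12 : 0 < a1 * a2 by rewrite nmulr_rgt0.
have -> : a1 * v + u * a2 = a1 * a2 * (u / a1 + v / a2).
  by field; rewrite !lt_eqF.
rewrite !(normrM (a1 * a2)) ltr_pM2l ?normr_gt0 ?gt_eqF //.
by rewrite (ltr0_norm a30).
Qed.

End RiccatiForm.

Theorem theorem4p2 (R : realType) (a1 a2 a3 b1 b2 c1 c2 : R) :
  let A : 'M[R]_3 := mx3_of_rows [:: [:: a1; 0;  0 ];
                                     [:: 0;  a2; 0 ];
                                     [:: c1; c2; a3]] in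
  let B : 'M[R]_3 := mx3_of_rows [:: [:: 0; 0; b1];
                                     [:: 0; 0; b2];
                                     [:: 0; 0; 0 ]] in
  diag_riccati_stable A B <->
  [/\ [/\ a1 < 0, a2 < 0 & a3 < 0],
      a1 * a3 > `|c1 * b1| /\ a2 * a3 > `|b2 * c2|
    & `|a1 * a2 * a3| > `|a1 * b2 * c2 + b1 * c1 * a2| ].
Proof.
move=> A B; rewrite -(mulrA a1 b2) (mulrC c1); split.
  case/riccati_formP=> p1 [p2 [p3 [q1 [q2 [q3 [[p10 p20 p30] [q10 q20 q30]]]]]]].
  case/riccati_necessary=> // -[a10 a20 a30].
  by rewrite !ltr_norm_ndiv // ltr_norm_sum_div.
case=> -[a10 a20 a30] [].
rewrite -!ltr_norm_ndiv // -ltr_norm_sum_div //.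
exact: riccati_sufficient.
Qed.
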